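(* Let $d\ge 1$ be an integer, let $r_{\min}\ge 0$, let $\gamma\ge 1$. For any non-negative real numbers (smoothed importance scores) $\bar s_1,\dots,\bar s_d\ge 0$ and any budget $B\in(r_{\min},1]$, the rates $$r_j=r_{\min}+\tilde s_j\,(B d-r_{\min}d),\qquad \tilde s_j=\frac{\bar s_j^{\,\gamma}}{\sum_{j'=1}^d \bar s_{j'}^{\,\gamma}},\qquad j=1,\dots,d,$$ (before clipping) satisfy $$\frac1d\sum_{j=1}^d r_j=B .$$
   Context: There are $d$ sensor channels; $\bar s_j$ is the smoothed importance score of channel $j$, $B$ is the total bandwidth budget (average sampling rate), $r_{\min}$ is the minimum sampling rate per channel, $\gamma\ge1$ is a sharpness exponent ($\gamma=1$ gives allocation proportional to $\bar s_j$), and $r_j$ is the sampling rate allocated to channel $j$. In the algorithm the rates are subsequently clipped to the interval $[r_{\min},1]$; the claim concerns the rates before this clipping.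
   Formalization: The formal theorem additionally assumes that the sum of the powers of the scores is nonzero, i.e. that the importance scores are not all zero; when they are all zero the normalized scores are 0/0 and the rates are undefined. *)

(* Defs.v *)
From mathcomp Require Import all_boot all_order all_algebra.
From mathcomp Require Import reals exp.

Set Implicit Arguments.
Unset Strict Implicit.
Unset Printing Implicit Defensive.

Import Order.TTheory GRing.Theory Num.Theory.

Local Open Scope ring_scope.

(* [`^] is the real power [powR]; since [0 `^ gamma = 0] for [gamma != 0], it
   is the usual power of a nonnegative base for every exponent [gamma >= 1].
   [x / 0 = 0] in MathComp, so the quotient has its ordinary meaning only when
   the scores are not all zero. *)
Definition normalized_score (R : realType) (d : nat) (gamma : R)
    (s : 'I_d -> R) (j : 'I_d) : R :=
  s j `^ gamma / \sum_(i < d) s i `^ gamma.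

(* The rate before clipping to the interval [rmin, 1]. *)
Definition rate (R : realType) (d : nat) (rmin gamma B : R)
    (s : 'I_d -> R) (j : 'I_d) : R :=
  rmin + normalized_score gamma s j * (B * d%:R - rmin * d%:R).

(* Main.v *)
Require Import Defs.
From mathcomp Require Import all_boot all_order all_algebra.
From mathcomp Require Import reals exp.

Import Order.TTheory GRing.Theory Num.Theory.

Local Open Scope ring_scope.

(** The normalized scores sum to 1, so the rates total [rmin * d + (B * d - rmin * d) = B * d].
    [hden] excludes all-zero scores, for which every rate would be [rmin < B]. *)

Theorem proposition1 (R : realType) (d : nat) (hd : (1 <= d)%N)
    (rmin : R) (hrmin : 0 <= rmin) (gamma : R) (hgamma : 1 <= gamma)
    (s : 'I_d -> R) (hs : forall j : 'I_d, 0 <= s j)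
    (hden : \sum_(j < d) s j `^ gamma != 0)
    (B : R) (hB : rmin < B <= 1) :
  d%:R^-1 * \sum_(j < d) rate rmin gamma B s j = B.
Proof.
have d_neq0 : d%:R != 0 :> R by rewrite pnatr_eq0 -lt0n.
(* The first [mulr_suml] factors out the surplus [B * d - rmin * d], the second the common
   denominator inside [normalized_score]. *)
rewrite /rate big_split /= sumr_const card_ord -mulr_suml -mulr_suml.
(* [divff] uses [hden]: the scores' total share is 1. *)
rewrite divff // mul1r -(mulr_natr rmin) addrC subrK mulrC.
exact: mulfK.
Qed.
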